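(* Let $n\ge 2$, let $G = SD_{8n} = \langle x, y : x^{4n} = y^2 = 1,\ yxy = x^{2n -1}\rangle$, and let $\mathcal{CCC}(G)$ be its commuting conjugacy class graph. Then: (1) $$\mathrm{Spec}(\mathcal{CCC}(G)) = \begin{cases}\left\{(-1)^{2n}, 3^{1}, (2n - 3)^{1}\right\}, & \text{if } n \text{ is odd},\\ \left\{(-1)^{2n - 2}, 0^{2}, (2n - 2)^{1}\right\}, & \text{if } n \text{ is even},\end{cases}$$ and $$E(\mathcal{CCC}(G)) = \begin{cases}4n, & \text{if } n \text{ is odd},\\ 4n - 4, & \text{if } n \text{ is even}.\end{cases}$$ (2) $$\mathrm{L\text{-}Spec}(\mathcal{CCC}(G)) = \begin{cases}\left\{0^{2}, 4^3, (2n - 2)^{2n - 3}\right\}, & \text{if } n \text{ is odd},\\ \left\{0^{3}, (2n - 1)^{2n - 2}\right\}, & \text{if } n \text{ is even},\end{cases}$$ and $$LE(\mathcal{CCC}(G)) = \begin{cases}12, & \text{if } n = 3,\\ \frac{2(2n - 3)(5n - 11)}{n + 1}, & \text{if } n \text{ is odd and } n \geq 5,\\ \frac{6(2n - 1)(2n - 2)}{2n + 1}, & \text{if } n \text{ is even}.\end{cases}$$ (3) $$\mathrm{Q\text{-}Spec}(\mathcal{CCC}(G)) = \begin{cases}\left\{6^1, 2^{3}, (4n - 6)^{1}, (2n - 4)^{2n - 3}\right\}, & \text{if } n \text{ is odd},\\ \left\{0^{2}, (4n - 4)^{1}, (2n - 3)^{2n - 2}\right\}, & \text{if } n \text{ is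 even},\end{cases}$$ and $$LE^+(\mathcal{CCC}(G)) = \begin{cases}12, & \text{if } n = 3,\\ 22, & \text{if } n = 5,\\ \frac{16(n - 1)(n - 3)}{n + 1}, & \text{if } n \text{ is odd and } n \geq 7,\\ \frac{28}{5}, & \text{if } n = 2,\\ \frac{4(2n - 1)(2n - 2)}{2n + 1}, & \text{if } n \text{ is even and } n \geq 4.\end{cases}$$
   Context: For a finite non-abelian group $G$, the commuting conjugacy class graph $\mathcal{CCC}(G)$ is the simple undirected graph whose vertices are the conjugacy classes of the non-central elements of $G$; two distinct vertices $x^G$ and $y^G$ are adjacent iff there exist $x'\in x^G$ and $y'\in y^G$ with $x'y'=y'x'$. For a finite graph $\mathcal{G}$ with adjacency matrix $A(\mathcal{G})$ and (diagonal) degree matrix $D(\mathcal{G})$, put $L(\mathcal{G})=D(\mathcal{G})-A(\mathcal{G})$ and $Q(\mathcal{G})=D(\mathcal{G})+A(\mathcal{G})$. $\mathrm{Spec}(\mathcal{G})$, $\mathrm{L\text{-}Spec}(\mathcal{G})$, $\mathrm{Q\text{-}Spec}(\mathcal{G})$ are the multisets of eigenvalues of $A(\mathcal{G})$, $L(\mathcal{G})$, $Q(\mathcal{G})$ respectively. In the notation $\{\alpha_1^{a_1},\dots,\alpha_l^{a_l}\}$ the exponent is a multiplicity; if listed values coincide their multiplicities are added. With $d=\frac{2|e(\mathcal{G})|}{|V(\mathcal{G})|}$ ($|V(\mathcal{G})|$ the number of vertices, $|e(\mathcal{G})|$ the number of edges), the energy, Laplacian energy and signless Laplacian energy (sums with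 multiplicity) are $E(\mathcal{G})=\sum_{\lambda\in \mathrm{Spec}(\mathcal{G})}|\lambda|$, $LE(\mathcal{G})=\sum_{\mu\in \mathrm{L\text{-}Spec}(\mathcal{G})}|\mu-d|$, $LE^+(\mathcal{G})=\sum_{\nu\in \mathrm{Q\text{-}Spec}(\mathcal{G})}|\nu-d|$. *)

(* Defs.v *)
From HB Require Import structures.
From mathcomp Require Import all_boot all_order all_algebra all_fingroup.
From mathcomp Require Import all_solvable.
Set Implicit Arguments.
Unset Strict Implicit.
Unset Printing Implicit Defensive.
Import Order.TTheory GRing.Theory Num.Theory.
Local Open Scope ring_scope.

Record sgraph := SGraph {
  vertex :> finType;
  adj : rel vertex;
  adj_sym : symmetric adj;
  adj_irrefl : irreflexive adj
}.

Section GraphMatrices.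
Variables (C : numClosedFieldType) (V : sgraph).

Definition edges : {set {set V}} :=
  [set [set u; v] | u in [set: V], v in [set: V] & adj u v].

(* Vertices are numbered along [enum V]; the spectra do not depend on this. *)
Definition adj_mx : 'M[C]_#|V| :=
  \matrix_(i, j) (adj (enum_val i) (enum_val j))%:R.

Definition deg_mx : 'M[C]_#|V| :=
  diag_mx (\row_i #|[set v : V | adj (enum_val i) v]|%:R).

Definition lap_mx : 'M[C]_#|V| := deg_mx - adj_mx.
Definition slap_mx : 'M[C]_#|V| := deg_mx + adj_mx.

Definition avg_deg : C := (2 * #|edges|)%:R / #|V|%:R.

End GraphMatrices.

(* The roots of the characteristic polynomial, listed with multiplicity in an
   unspecified order: spectra are to be compared up to [perm_eq]. *)
Definition eigenvalues (C : numClosedFieldType) (m : nat) (A : 'M[C]_m) :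
  seq C := sval (closed_field_poly_normal (char_poly A)).

Section Spectra.
Variables (C : numClosedFieldType) (V : sgraph).

Definition Spec : seq C := eigenvalues (adj_mx C V).
Definition LSpec : seq C := eigenvalues (lap_mx C V).
Definition QSpec : seq C := eigenvalues (slap_mx C V).

Definition energy : C := \sum_(l <- Spec) `|l|.
Definition Lenergy : C := \sum_(m <- LSpec) `|m - avg_deg C V|.
Definition Qenergy : C := \sum_(v <- QSpec) `|v - avg_deg C V|.

End Spectra.

Section CommutingConjugacyClassGraph.
Variables (gT : finGroupType) (G : {group gT}).
Local Open Scope group_scope.

Definition noncentral_classes : {set {set gT}} :=
  [set x ^: G | x in G :\: 'Z(G)].

Definition ccc_vertex : finType := {X : {set gT} | X \in noncentral_classes}.

Definition ccc_adj (X Y : ccc_vertex) : bool :=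
  (X != Y) && [exists x in val X, exists y in val Y, x * y == y * x].

Lemma ccc_adj_sym : symmetric ccc_adj.
Proof.
move=> X Y; rewrite /ccc_adj eq_sym; congr (_ && _).
by apply/exists_inP/exists_inP => -[x Xx /exists_inP[y Yy /eqP xy]];
  exists y => //; apply/exists_inP; exists x; rewrite // xy.
Qed.

Lemma ccc_adj_irrefl : irreflexive ccc_adj.
Proof. by move=> X; rewrite /ccc_adj eqxx. Qed.

Definition CCC : sgraph := SGraph ccc_adj_sym ccc_adj_irrefl.

End CommutingConjugacyClassGraph.

(* Main.v *)
Require Import Defs.
From HB Require Import structures.
From mathcomp Require Import all_boot all_order all_algebra all_fingroup.
From mathcomp Require Import all_solvable ring zify.
Import Order.TTheory GRing.Theory Num.Theory.
Local Open Scope ring_scope.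

(** The subgroup [H = <x>] is abelian of index 2, [Z(G)] lies in [H], and every
    [g] outside [H] acts on [H] by [h |-> h ^+ (2n - 1)].  Hence a noncentral
    class inside [H] has 2 elements, a class outside [H] has [#|H| / #|Z(G)|],
    and no element outside [H] commutes with a noncentral one of [H].  The class
    of [g] outside [H] contains every [g * h ^+ (2n - 2)], and [Z(G)] has order 4 or 2
    according to the parity of [n]; so for [n] odd the graph is
    [K_(2n-2) + K_4], and for [n] even it is [K_(2n-1) + 2 K_1].

    The adjacency, Laplacian and signless Laplacian matrices of a disjoint union
    of cliques all have the form [diag(a) + b P P^T], where [P] is the incidence
    matrix of vertices in components and [a] is constant on components; Schur
    complements turn the characteristic polynomial into a product over the
    components. *)

(** * Characteristic polynomials by Schur complements, root lists, and edge counting *)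

(* Both sides equal [\det F * \det (block_mx E B D 1%:M)]: the intertwining
   hypothesis replaces the invertibility of [E], which fails for a diagonal
   characteristic matrix over a polynomial ring. *)
Lemma det_sub_mulmx {R : comNzRingType} {m p : nat} (E : 'M[R]_m) (F : 'M_p)
    (B : 'M_(m, p)) (D : 'M_(p, m)) :
  D *m E = F *m D -> \det F * \det (E - B *m D) = \det E * \det (F - D *m B).
Proof.
move=> DE_FD; pose M := block_mx E B D 1%:M.
have detM : \det M = \det (E - B *m D).
  rewrite -[RHS]mulr1 -(det1 R p) -(det_lblock _ D).
  have -> : block_mx (E - B *m D) 0 D 1%:M = block_mx 1%:M (- B) 0 1%:M *m M.
    by rewrite mulmx_block !mul1mx !mul0mx !mulmx1 !add0r mulNmx subrr.
  by rewrite det_mulmx det_ublock !det1 !mul1r.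
rewrite -detM -[\det F]mul1r -(det1 R m) -(det_lblock _ (- D)) -det_mulmx.
rewrite mulmx_block !mul1mx !mul0mx !mulmx1 !addr0 mulNmx DE_FD addNr.
by rewrite det_ublock mulNmx [- _ + F]addrC.
Qed.

(** The characteristic matrix is [E - B *m D] with [D] the incidence matrix of the clusters. As the
    clusters are disjoint, [D *m B] is diagonal, so the m by m determinant is traded for a p by p
    diagonal one at the cost of one factor [q i] per cluster; sizes are successors so that this
    factor is available. *)
Lemma char_poly_clustered {C : fieldType} {m p : nat} (f : 'I_m -> 'I_p)
    (a : 'I_p -> C) (b : C) (k : 'I_p -> nat) :
  (forall i, #|[set u | f u == i]| = (k i).+1) ->
  char_poly (\matrix_(u, v) (a (f u) *+ (u == v) + b *+ (f u == f v))) =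
    \prod_i (('X - (a i)%:P) ^+ k i * ('X - (a i + b *+ (k i).+1)%:P)).
Proof.
move=> kE; pose q i : {poly C} := 'X - (a i)%:P.
pose E := diag_mx (\row_u q (f u)); pose F := diag_mx (\row_i q i).
pose B := \matrix_(u < m, i < p) (b%:P *+ (f u == i)).
pose D := \matrix_(i < p, u < m) ((f u == i)%:R : {poly C}).
have DE_FD : D *m E = F *m D.
  apply/matrixP=> i u; rewrite mul_mx_diag mul_diag_mx !mxE mulrC.
  by case: eqP => [->|] //; rewrite !mulr0.
have prodE : \det E = \prod_i q i ^+ (k i).+1.
  rewrite det_diag (partition_big f predT) //=; apply: eq_bigr => i _.
  rewrite -kE -prodr_const; apply: eq_big => [u|u /eqP <-]; first by rewrite inE.
  by rewrite mxE.
have DB : D *m B = diag_mx (\row_i (b%:P *+ (k i).+1)).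
  apply/matrixP=> i j; rewrite !mxE; under eq_bigr do rewrite !mxE.
  have [<-|ne_ij] := eqVneq i j; last first.
    rewrite big1 // => u _; case: eqP => [->|]; last by rewrite mul0r.
    by rewrite (negPf ne_ij) mulr0.
  rewrite mulr1n -kE -sumr_const [RHS]big_mkcond; apply: eq_bigr => u _.
  by rewrite inE; case: ifP; rewrite ?mul1r ?mul0r.
have detF : \det F = \prod_i q i.
  by rewrite det_diag; apply: eq_bigr => i _; rewrite mxE.
have q_neq0 i : q i != 0 by rewrite polyXsubC_eq0.
have F_neq0 : \det F != 0 by rewrite detF; apply/prodf_neq0.
(* Polynomials over a field form an integral domain, so the extra factor [\det F] can be
   cancelled. *)
apply: (mulfI F_neq0); rewrite /char_poly.
have -> : char_poly_mx (\matrix_(u, v) (a (f u) *+ (u == v) + b *+ (f u == f v)))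
          = E - B *m D.
  apply/matrixP=> u v; rewrite !mxE; under eq_bigr do rewrite !mxE.
  rewrite (bigD1 (f v)) //= eqxx mulr1 big1 ?addr0 => [|i /negPf].
    rewrite rmorphD !rmorphMn /= /q.
    by case: eqP => _; rewrite ?mulr1n ?mulr0n ?opprD ?addrA ?subr0.
  by rewrite [f v == i]eq_sym => ->; rewrite mulr0.
rewrite det_sub_mulmx // prodE detF DB -raddfB /= det_diag -!big_split /=.
apply: eq_bigr => i _; rewrite exprS -!mulrA; congr (_ * (_ * _)).
by rewrite !mxE rmorphD rmorphMn /= opprD addrA.
Qed.

(** The characteristic polynomial is monic, and a product of monic linear factors determines its
    roots up to order, whichever list [eigenvalues] picks. *)
Lemma eigenvalues_perm {C : numClosedFieldType} {m : nat} (A : 'M[C]_m)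
    (s : seq C) :
  char_poly A = \prod_(z <- s) ('X - z%:P) -> perm_eq (eigenvalues A) s.
Proof.
move=> chA; apply: prod_XsubC_eq; rewrite -chA /eigenvalues.
case: closed_field_poly_normal => r /= chr.
by rewrite [RHS]chr (monicP (char_poly_monic A)) scale1r.
Qed.

(** Handshake count of the ordered adjacent pairs: grouped by first component they give the degrees,
    grouped by underlying edge they come in twos, the ends being distinct by irreflexivity. *)
Lemma sum_deg (V : sgraph) :
  (2 * #|edges V|)%N = (\sum_(v : V) #|[set w | adj v w]|)%N.
Proof.
transitivity #|[set e : V * V | @adj V e.1 e.2]|; last first.
  rewrite -sum1_card (eq_bigl (fun e : V * V => @adj V e.1 e.2)); last first.
    by move=> e; rewrite inE.
  rewrite -(pair_big_dep predT (@adj V) (fun _ _ => 1%N)) /=.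
  by apply: eq_bigr => v _; rewrite sum1dep_card.
rewrite mulnC -sum_nat_const -[RHS]sum1_card.
rewrite (partition_big (fun e : V * V => [set e.1; e.2]) [in edges V]) /=; last first.
  move=> [u v]; rewrite inE /= => uv.
  by apply/imset2P; exists u v; rewrite ?inE.
apply: eq_bigr => e /imset2P[u v _]; rewrite inE => /andP[_ uv] ->.
have ne_uv : u != v by apply: contraTneq uv => ->; rewrite adj_irrefl.
transitivity #|[set (u, v); (v, u)]|.
  by rewrite cards2 xpair_eqE (negPf ne_uv).
rewrite -sum1_card; apply: eq_bigl => -[a b]; rewrite !inE /= !xpair_eqE.
apply/orP/andP => [[]/andP[/eqP-> /eqP->]|[ab /eqP/setP eq_ab]].
- by [].
- by rewrite adj_sym setUC.
move: (eq_ab a) (eq_ab b) ab; rewrite !inE !eqxx orbT /=.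
case: (eqVneq a u) => [->|_]; case: (eqVneq b v) => [->|_] //=.
- by left.
- by rewrite orbF => _ /esym/eqP ->; rewrite adj_irrefl.
- by move=> /esym/eqP->; rewrite adj_irrefl.
by rewrite orbF => /esym/eqP-> /esym/eqP->; rewrite !eqxx; right.
Qed.

(** * Spectra and energies of a disjoint union of cliques *)

Section ClusterGraph.

(* [ks] lists the degrees in the components, i.e. their sizes minus one. *)
Context {C : numClosedFieldType} {V : sgraph} (ks : seq nat).
Context (f : V -> 'I_(size ks)).
Local Notation k i := (nth 0%N ks i).
Hypothesis adjE : forall u v : V, adj u v = (u != v) && (f u == f v).
Hypothesis kE : forall i, #|[set v : V | f v == i]| = (k i).+1.

Let card_ord i : #|[set u : 'I_#|V| | f (enum_val u) == i]| = (k i).+1.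
Proof.
rewrite -kE -(card_imset _ enum_val_inj); apply: eq_card => v.
rewrite !inE; apply/imsetP/idP => [[u]|fv]; first by rewrite inE => fu ->.
by exists (enum_rank v); rewrite ?inE enum_rankK.
Qed.

Lemma cluster_deg (v : V) : #|[set w : V | adj v w]| = k (f v).
Proof.
apply: succn_inj; rewrite -kE (cardsD1 v [set w | f w == _]) !inE eqxx.
by congr _.+1; apply: eq_card => w; rewrite !inE adjE eq_sym [f v == _]eq_sym.
Qed.

(** In all three matrices the diagonal coefficient depends on a component only through its degree;
    hence [a] is a function of [k] and the product runs over the list [ks]. *)
Lemma char_poly_cluster {a : nat -> C} {b : C} {A : 'M[C]_#|V|} :
    (forall u v, A u v = a (k (f (enum_val u))) *+ (u == v)
                         + b *+ (f (enum_val u) == f (enum_val v))) ->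
  char_poly A =
    \prod_(k <- ks) (('X - (a k)%:P) ^+ k * ('X - (a k + b *+ k.+1)%:P)).
Proof.
move=> AE; rewrite (big_nth 0%N) big_mkord.
rewrite -(char_poly_clustered (fun u => f (enum_val u)) (fun i => a (k i)) b
           (fun i => k i) card_ord).
by congr char_poly; apply/matrixP=> u v; rewrite AE mxE.
Qed.

Let eigenvalues_cluster (a : nat -> C) (b : C) {A : 'M[C]_#|V|} :
    (forall u v, A u v = a (k (f (enum_val u))) *+ (u == v)
                         + b *+ (f (enum_val u) == f (enum_val v))) ->
  perm_eq (eigenvalues A)
    (flatten [seq rcons (nseq k (a k)) (a k + b *+ k.+1) | k <- ks]).
Proof.
move=> AE; apply: eigenvalues_perm; rewrite (char_poly_cluster AE).
rewrite big_flatten big_map; apply: eq_bigr => k _.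
by rewrite -cats1 big_cat big_seq1 big_nseq iter_mulr_1.
Qed.

Let adjE_ord (u v : 'I_#|V|) : (adj (enum_val u) (enum_val v))%:R
    = (f (enum_val u) == f (enum_val v))%:R - (u == v)%:R :> C.
Proof.
rewrite adjE (inj_eq enum_val_inj); have [->|] := eqVneq; last by rewrite subr0.
by rewrite eqxx subrr.
Qed.

Let degE_ord (u v : 'I_#|V|) :
  deg_mx C V u v = (k (f (enum_val u)))%:R *+ (u == v).
Proof. by rewrite !mxE cluster_deg. Qed.

(** Adjacency is [P P^T - 1], that is [a = -1] and [b = 1]. Adding or subtracting it from the
    degrees gives [a = k + 1], [b = -1] for the Laplacian and [a = k - 1], [b = 1] for the signless
    one. *)
Lemma Spec_cluster :
  perm_eq (Spec C V) (flatten [seq rcons (nseq k (-1)) k%:R | k <- ks]).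
Proof.
rewrite (permPl (eigenvalues_cluster (fun=> -1) 1 _)) => [|u v].
  by under eq_map do rewrite [_.+1%:R]mulrS addKr.
by rewrite mxE adjE_ord addrC mulNrn.
Qed.

Lemma LSpec_cluster :
  perm_eq (LSpec C V) (flatten [seq rcons (nseq k k.+1%:R) 0 | k <- ks]).
Proof.
rewrite (permPl (eigenvalues_cluster (fun k => k.+1%:R) (-1) _)) => [|u v].
  by under eq_map do rewrite mulNrn subrr.
by rewrite mxE degE_ord !mxE adjE_ord; case: eqP => _; rewrite ?mulrS; ring.
Qed.

(* For [k = 0] the truncated [k.-1] has multiplicity 0. *)
Lemma QSpec_cluster :
  perm_eq (QSpec C V) (flatten [seq rcons (nseq k k.-1%:R) (2 * k)%:R | k <- ks]).
Proof.
rewrite (permPl (eigenvalues_cluster (fun k => k%:R - 1) 1 _)) => [|u v].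
  have e k : rcons (nseq k (k%:R - 1)) (k%:R - 1 + k.+1%:R)
             = rcons (nseq k k.-1%:R) (2 * k)%:R :> seq C.
    case: k => [|k] /=; first by rewrite sub0r addNr.
    have -> : k.+1%:R - 1 = k%:R :> C by ring.
    by congr (_ :: rcons _ _); ring.
  under eq_map => k do rewrite e.
  exact: perm_refl.
by rewrite mxE degE_ord !mxE adjE_ord; case: eqP => _; rewrite ?mulr1n ?mulr0n; ring.
Qed.

Lemma avg_deg_cluster : avg_deg C V =
  (\sum_(k <- ks) k.+1 * k)%:R / (\sum_(k <- ks) k.+1)%:R.
Proof.
have sum_ks (F : nat -> nat) :
  (\sum_(k <- ks) F k = \sum_(i < size ks) F (k i))%N.
  by rewrite (big_nth 0%N) big_mkord.
rewrite /avg_deg sum_deg !sum_ks; congr (_%:R / _%:R).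
  rewrite (partition_big f predT) //=; apply: eq_bigr => i _.
  rewrite -kE -sum_nat_const; apply: eq_big => [v|v /eqP <-]; first by rewrite inE.
  exact: cluster_deg.
rewrite -sum1_card (partition_big f predT) //=; apply: eq_bigr => i _.
by rewrite -kE -sum1_card; apply: eq_bigl => v; rewrite inE.
Qed.

Let sum_cluster (a b : nat -> C) (F : C -> C) :
  \sum_(z <- flatten [seq rcons (nseq k (a k)) (b k) | k <- ks]) F z
    = \sum_(k <- ks) (F (a k) *+ k + F (b k)).
Proof.
rewrite big_flatten big_map; apply: eq_bigr => k _.
by rewrite -cats1 big_cat big_seq1 big_nseq iter_addr_0.
Qed.

Lemma energy_cluster : energy C V = \sum_(k <- ks) (2 * k)%:R.
Proof.
rewrite /energy (perm_big _ Spec_cluster) sum_cluster.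
by apply: eq_bigr => k _; rewrite normrN1 normr_nat mul2n -addnn natrD.
Qed.

Lemma Lenergy_cluster : Lenergy C V =
  \sum_(k <- ks) (`|k.+1%:R - avg_deg C V| *+ k + `|0%:R - avg_deg C V|).
Proof. by rewrite /Lenergy (perm_big _ LSpec_cluster) sum_cluster. Qed.

Lemma Qenergy_cluster : Qenergy C V =
  \sum_(k <- ks) (`|k.-1%:R - avg_deg C V| *+ k + `|(2 * k)%:R - avg_deg C V|).
Proof. by rewrite /Qenergy (perm_big _ QSpec_cluster) sum_cluster. Qed.

End ClusterGraph.

(** * From the presentation to a cyclic subgroup of index 2 *)

Section SemidihedralGroup.

Local Open Scope group_scope.

Context {n : nat} (n_gt1 : (1 < n)%N).

(** The relations alone only bound the order from above; this concrete semidirect product of order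
    8n satisfies them and supplies the lower bound. *)
Lemma semidihedral_model_hom :
  [set: Extremal.gtype (4 * n) 2 (2 * n - 1)] \homg
    Grp (x : y : x ^+ (4 * n)%N, y ^+ 2, y * x * y = x ^+ (2 * n - 1)%N).
Proof.
have q_gt1 : (1 < 4 * n)%N by lia.
suffices isoG : [set: Extremal.gtype (4 * n) 2 (2 * n - 1)] \isog
    Grp (x : y : x ^+ (4 * n), y ^+ 2, x ^ y = x ^+ (2 * n - 1)).
  case/existsP: (isoGrp_hom isoG) => -[x y] /=.
  rewrite !xpair_eqE => /and4P[defG xq y2 /eqP xy].
  apply/existsP; exists (x, y); rewrite /= !xpair_eqE defG xq y2 /=.
  by rewrite -xy conjgE (eqP (_ : y^-1 == y)) ?mulgA // eq_invg_mul -expg2.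
(* The modulus 4n is spelled as the order of [Zp1] because [Zp_unitm] turns units modulo the order
   of an element into automorphisms of the cycle it generates. *)
set Z := 'Z_#[Zp1 : 'Z_(4 * n)]; pose e : Z := (2 * n - 1)%:R%R.
have o1 : #[Zp1 : 'Z_(4 * n)] = (4 * n)%N by rewrite order_Zp1 Zp_cast.
have q0 q : q = #[Zp1 : 'Z_(4 * n)] -> (q%:R = 0 :> Z)%R.
  by move->; apply: pchar_Zp; rewrite o1.
(* Since (2n - 1)^2 = 4n(n - 1) + 1, multiplication by 2n - 1 is an automorphism whose square is the
   identity. *)
have ee : (e * e = 1)%R.
  rewrite -natrM (_ : (2 * n - 1) * (2 * n - 1) = 4 * n * n.-1 + 1)%N; last first.
    by move: (n) n_gt1 => [|m] // _; rewrite (_ : 2 * m.+1 - 1 = 2 * m + 1)%N; lia.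
  by rewrite natrD natrM q0 ?mul0r ?add0r ?o1.
have e_unit : e \is a GRing.unit by apply/unitrPr; exists e.
pose u : {unit Z} := FinRing.unit Z e_unit.
apply: Extremal.Grp => //; exists (Zp_unitm u).
rewrite Aut_aut order_injm ?injm_Zp_unitm ?in_setT //; split=> //.
  by rewrite order_dvdn -val_eqE /= ee.
apply/eqP; rewrite autE ?cycle_id // eq_expg_mod_order /=.
by rewrite /e Zp_nat /= o1 !Zp_cast // modn_mod.
Qed.

Context {gT : finGroupType} (G : {group gT}).
Hypothesis isoG : G \isog
  Grp (x : y : x ^+ (4 * n)%N, y ^+ 2, y * x * y = x ^+ (2 * n - 1)%N).

(** The relations bound the orders of [x] and [y] by 4n and 2, and the order of [G] by their
    product; the model forces at least 8n, so all these bounds are attained. *)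
Lemma semidihedral_generators : exists x, [/\ <[x]> \subset G,
  #[x] = (4 * n)%N, #|G : <[x]>| = 2%N &
  {in G :\: <[x]>, forall g, {in <[x]>, forall h, h ^ g = h ^+ (2 * n - 1)%N}}].
Proof.
have leG : (2 * (4 * n) <= #|G|)%N.
  rewrite -(@Extremal.card (4 * n) 2 (2 * n - 1)) //; last by lia.
  by apply: leq_homg; rewrite isoG semidihedral_model_hom.
case/existsP: (isoGrp_hom isoG) => -[x y] /=.
rewrite !xpair_eqE => /and4P[/eqP defG /eqP xq /eqP y2 /eqP yxy].
have xy : x ^ y = x ^+ (2 * n - 1).
  by rewrite -yxy conjgE (eqP (_ : y^-1 == y)) ?mulgA // eq_invg_mul -expg2 y2.
have ox : (#[x] <= 4 * n)%N by apply: dvdn_leq; [lia | rewrite order_dvdn xq].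
have oy : (#[y] <= 2)%N by apply: dvdn_leq => //; rewrite order_dvdn y2.
have nxy : <[y]> \subset 'N(<[x]>) by rewrite norms_cycle xy mem_cycle.
have GE : <[x]> * <[y]> = G by rewrite -defG norm_joinEr.
have sxG : <[x]> \subset G by rewrite -GE mulG_subl.
have oG : (#|G| <= #[x] * #[y])%N.
  rewrite -GE !orderE (mul_cardG <[x]> <[y]>).
  by rewrite leq_pmulr // cardG_gt0.
have {ox}o_x : #[x] = (4 * n)%N by nia.
have iG : #|G : <[x]>| = 2%N.
  have := Lagrange sxG; rewrite -orderE o_x => oGE.
  have leG2 : (#|G| <= 4 * n * 2)%N by rewrite (leq_trans oG) // o_x leq_mul.
  apply/eqP; rewrite -(@eqn_pmul2l (4 * n)); last by lia.
  by rewrite eqn_leq oGE; lia.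
(* Write g as [h1 * y ^+ i]: outside the cycle i is odd, and [h1] commutes with h, so g acts as [y]
   does. *)
exists x; split=> // g /setDP[]; rewrite -GE => /mulsgP[h1 _ h1x /cycleP[i ->] ->].
rewrite -(expg_mod _ y2) modn2; case: odd; rewrite ?mulg1 ?h1x // => _ h hx.
rewrite conjgM (conjgE h) (centsP (cycle_abelian x) h hx h1) // mulKg.
by case/cycleP: hx => j ->; rewrite conjXg xy expgAC.
Qed.

End SemidihedralGroup.

(** * Counting the vertices contained in an invariant set *)

Section ConjugacyClasses.

Local Open Scope group_scope.

Context {gT : finGroupType} {G : {group gT}}.

Lemma class_subset_norm (D : {set gT}) (x : gT) :
  G \subset 'N(D) -> (x ^: G \subset D) = (x \in D).
Proof.
move=> nDG; apply/idP/idP => [/subsetP->//|xD]; first exact: class_refl.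
by apply/subsetP=> _ /imsetP[g gG ->]; rewrite memJ_norm // (subsetP nDG).
Qed.

Lemma ccc_vertexP (X : ccc_vertex G) :
  exists2 x, x \in G :\: 'Z(G) & val X = x ^: G.
Proof. exact: imsetP (valP X). Qed.

Lemma ccc_vertex_class (x : gT) : x \in G :\: 'Z(G) ->
  {X : ccc_vertex G | val X = x ^: G}.
Proof.
move=> xGZ; have xP : x ^: G \in noncentral_classes G by apply: imset_f.
by exists (exist (fun A => A \in noncentral_classes G) _ xP).
Qed.

(** The noncentral classes inside an invariant [D] are the blocks of a partition of [D :\: 'Z(G)];
    blocks of equal size are counted through the cardinal of their union. *)
Lemma card_ccc_vertex_uniform (D : {set gT}) (c : nat) :
    D \subset G -> G \subset 'N(D) ->
    {in D :\: 'Z(G), forall x, #|x ^: G| = c} ->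
  (#|[set X : ccc_vertex G | val X \subset D]| * c)%N = #|D :\: 'Z(G)|.
Proof.
move=> sDG nDG cE; pose P := [set x ^: G | x in D :\: 'Z(G)].
have partP : partition P (D :\: 'Z(G)).
  rewrite /P; under eq_imset do rewrite -orbitJ.
  by apply: orbit_partition; rewrite astabsJ normsD // normal_norm ?center_normal.
rewrite (card_uniform_partition (n := c) _ partP); last first.
  by move=> _ /imsetP[x xD ->]; apply: cE.
congr (_ * _)%N; rewrite -(card_imset _ val_inj); apply: eq_card => A.
apply/imsetP/imsetP => [[X]|[x xD ->]].
  have [x /setDP[_ xZ] Xx] := ccc_vertexP X; rewrite inE Xx class_subset_norm //.
  by move=> xD ->; exists x; rewrite // inE xZ.
have [|X Xx] := ccc_vertex_class x; first by rewrite (subsetP (setSD _ sDG)).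
by exists X; rewrite // inE Xx class_subset_norm //; case/setDP: xD.
Qed.

End ConjugacyClasses.

(** * Classes and adjacency in a nonabelian group with an abelian subgroup of index 2 *)

Section IndexTwoAbelian.

Local Open Scope group_scope.

Context {gT : finGroupType} {G H : {group gT}}.
Hypotheses (sHG : H \subset G) (iG : #|G : H| = 2%N) (cHH : abelian H).
Hypothesis nabG : ~~ abelian G.

Let nHG : G \subset 'N(H). Proof. exact/normal_norm/index2_normal. Qed.

Let oG : #|G| = (#|H| * 2)%N. Proof. by rewrite -iG Lagrange. Qed.

Lemma index2_coset {g : gT} : g \in G :\: H -> g *: H = G :\: H.
Proof.
case/setDP=> gG gH; apply/eqP; rewrite eqEcard card_lcoset cardsD.
rewrite (setIidPr sHG) oG muln2 -addnn addnK leqnn andbT.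
apply/subsetP=> _ /lcosetP[h hH ->].
by rewrite inE groupMr // gH groupM // (subsetP sHG).
Qed.

(** [G] is the union of [H] and [g *: H], so commuting with [g] and with the abelian [H] is
    commuting with everything. *)
Lemma index2_cent {g h : gT} :
  g \in G :\: H -> h \in H -> commute g h -> h \in 'Z(G).
Proof.
move=> gGH hH gh; rewrite inE (subsetP sHG) //=; apply/centP=> a aG.
have [aH|aH] := boolP (a \in H); first exact: (centsP cHH).
have: a \in g *: H by rewrite index2_coset // inE aH.
case/lcosetP=> b bH ->; apply: commuteM; first exact: commute_sym.
exact: (centsP cHH).
Qed.

(** A central z outside [H] would make all of [H] central, hence also [z *: H], and [G] would be
    abelian. *)
Lemma center_sub_index2 : 'Z(G) \subset H.
Proof.
apply/subsetP=> z zZ; apply: contraNT nabG => zH.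
have zG : z \in G :\: H by rewrite inE zH (subsetP (center_sub G)).
have sHZ : H \subset 'Z(G).
  apply/subsetP=> h hH; apply: (index2_cent zG hH).
  by apply/commute_sym/(centerC _ zZ)/(subsetP sHG).
apply: (abelianS _ (center_abelian G)); apply/subsetP=> g gG.
have [/(subsetP sHZ)//|gH] := boolP (g \in H).
have: g \in z *: H by rewrite index2_coset // inE gH.
by case/lcosetP=> h hH ->; rewrite groupM // (subsetP sHZ).
Qed.

(** The centralizer of a noncentral [h] in [H] is [H] itself. *)
Lemma card_class_in {h : gT} : h \in H :\: 'Z(G) -> #|h ^: G| = 2%N.
Proof.
case/setDP=> hH hZ; rewrite -index_cent1 -iG; congr #|_ : _|.
apply/setP=> g; rewrite inE cent1C; apply/andP/idP => [[gG /cent1P gh]|gH].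
  apply: contraNT hZ => gH; apply: (@index2_cent g) => //.
  by rewrite inE gH.
split; first exact: (subsetP sHG).
by apply/cent1P; apply: (centsP cHH).
Qed.

(** The centralizer of [g] meets [H] in the center and, containing [g], has product [G] with [H];
    the product formula and orbit-stabilizer then compare the orders. *)
Lemma card_class_out {g : gT} :
  g \in G :\: H -> (#|g ^: G| * #|'Z(G)|)%N = #|H|.
Proof.
move=> gGH; have /setDP[gG gH] := gGH.
have Cg_H : 'C_G[g] :&: H = 'Z(G).
  apply/setP=> h; apply/setIP/idP => [[/setIP[_ /cent1P gh] hH]|hZ].
    exact: (index2_cent gGH hH (commute_sym gh)).
  split; last exact: (subsetP center_sub_index2).
  rewrite inE (subsetP (center_sub G)) //=; apply/cent1P/commute_sym.
  exact: (centerC gG).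
have CgH : 'C_G[g] * H = G.
  apply/eqP; rewrite eqEsubset mul_subG ?subsetIl //=.
  rewrite -{1}(setID G H) (setIidPr sHG) subUset mulG_subr /= -(index2_coset gGH).
  by apply: mulSg; rewrite sub1set inE gG cent1id.
have := mul_cardG 'C_G[g] H; rewrite CgH Cg_H => cardC.
have := Lagrange (subsetIl G 'C[g]); rewrite index_cent1 => oG'.
have Cg_gt0 : (0 < #|'C_G[g]|)%N by rewrite cardG_gt0.
apply/eqP; rewrite -(eqn_pmul2l Cg_gt0) mulnA oG' cardC mulnC; exact/eqP.
Qed.

Lemma card_ccc_in :
  (#|[set X : ccc_vertex G | val X \subset H]| * 2 + #|'Z(G)| = #|H|)%N.
Proof.
rewrite (card_ccc_vertex_uniform _ _ sHG nHG) => [|x]; last exact: card_class_in.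
by rewrite cardsD (setIidPr center_sub_index2) subnK //
  subset_leq_card // center_sub_index2.
Qed.

Lemma ccc_outE (X : ccc_vertex G) :
  (val X \subset G :\: H) = ~~ (val X \subset H).
Proof.
have [x /setDP[xG _] ->] := ccc_vertexP X.
by rewrite !class_subset_norm ?normsD ?normG // inE xG andbT.
Qed.

(** The complement of [H] has [#|H|] elements, all noncentral, and splits into classes of size
    [#|H| / #|'Z(G)|]. *)
Lemma card_ccc_out :
  #|[set X : ccc_vertex G | ~~ (val X \subset H)]| = #|'Z(G)|.
Proof.
have Z_gt0 : (0 < #|'Z(G)|)%N by rewrite cardG_gt0.
have dZ : G :\: H :\: 'Z(G) = G :\: H.
  by rewrite setDDl (setUidPl center_sub_index2).
have nGH : G \subset 'N(G :\: H) by rewrite normsD ?normG.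
have := card_ccc_vertex_uniform (G :\: H) (#|H| %/ #|'Z(G)|) (subsetDl _ _) nGH.
rewrite dZ cardsD (setIidPr sHG) oG muln2 -addnn addnK.
rewrite (eq_finset _ ccc_outE).
move=> /(_ _)/wrap[x xGH|cardE].
  by rewrite -(card_class_out xGH) mulnK.
have oH : (#|H| %/ #|'Z(G)| * #|'Z(G)|)%N = #|H|.
  by rewrite divnK // cardSg // center_sub_index2.
have: (0 < #|H|)%N by rewrite cardG_gt0.
move: cardE; rewrite -{2 3}oH mulnC muln_gt0 => /eqP; rewrite eqn_mul2l.
by case: eqP => [->|_ /eqP] //.
Qed.

(** An element outside [H] commuting with a conjugate of x would make that conjugate, hence x,
    central; two elements of [H] always commute. *)
Lemma ccc_adj_in (X Y : ccc_vertex G) : val X \subset H ->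
  ccc_adj X Y = (X != Y) && (val Y \subset H).
Proof.
rewrite /ccc_adj; have [x /setDP[xG xZ] ->] := ccc_vertexP X.
have [y /setDP[yG yZ] ->] := ccc_vertexP Y.
rewrite !class_subset_norm // => xH; congr (_ && _).
apply/exists_inP/idP => [[_ /imsetP[g gG ->] /exists_inP[b byG /eqP ab]]|yH].
  have bGH : b \in H -> y \in H.
    by case/imsetP: byG => k kG ->; rewrite memJ_norm // (subsetP nHG).
  apply: contraNT xZ => yH; suff: x ^ g \in 'Z(G).
    by rewrite memJ_norm // (subsetP (normal_norm (center_normal G))).
  apply: (@index2_cent b); last by [].
    rewrite inE (contra bGH) //= (subsetP _ _ byG) //.
    by rewrite class_subset_norm ?normG.
  by rewrite memJ_norm // (subsetP nHG).
exists x; rewrite ?class_refl //; apply/exists_inP; exists y => //.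
  exact: class_refl.
exact/eqP/(centsP cHH).
Qed.

Lemma ccc_adj_out (X Y : ccc_vertex G) {x y : gT} :
    x \in G :\: H -> y \in G :\: H -> val X = x ^: G -> val Y = y ^: G ->
  ccc_adj X Y = (X != Y) && [exists z in 'Z(G), x * z \in y ^: G].
Proof.
move=> xGH yGH; have /setDP[xG xH] := xGH; have /setDP[yG yH] := yGH.
rewrite /ccc_adj => -> ->; congr (_ && _).
apply/exists_inP/exists_inP => [[_ /imsetP[g gG ->] /exists_inP[b byG /eqP ab]]|].
  (* Conjugating the commuting pair [x ^ g], [b] back by [g^-1] gives [x] and [b ^ g^-1], both
     outside [H]; their quotient lies in [H] and commutes with [x], so it is central. *)
  exists (x^-1 * b ^ g^-1); last first.
    by rewrite mulKVg memJ_norm ?groupV // (subsetP (class_norm _ _)).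
  have bGH : b ^ g^-1 \in G :\: H.
    rewrite memJ_norm; last by rewrite groupV (subsetP (normsD (normG _) nHG)).
    by rewrite (subsetP _ _ byG) // class_subset_norm // normsD ?normG.
  apply: (index2_cent xGH).
    by rewrite -(index2_coset xGH) mem_lcoset in bGH.
  apply: commuteM; first exact/commuteV.
  by rewrite /commute -(conjgK g x) -!conjMg ab.
case=> z zZ xzy; exists x; first exact: class_refl.
apply/exists_inP; exists (x * z) => //.
by rewrite -mulgA; apply/eqP; congr (_ * _); apply: (centerC xG).
Qed.

End IndexTwoAbelian.

(** * Center and outer classes of the semidihedral group, by parity of n *)

Section SemidihedralCCC.

Local Open Scope group_scope.

Context {n : nat} (n_gt1 : (1 < n)%N) {gT : finGroupType} {G : {group gT}} {x : gT}.
Local Notation H := <[x]>.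
Hypotheses (sHG : H \subset G) (ox : #[x] = (4 * n)%N) (iG : #|G : H| = 2%N).
Hypothesis conjE :
  {in G :\: H, forall g, {in H, forall h, h ^ g = h ^+ (2 * n - 1)}}.

Let cHH : abelian H := cycle_abelian x.

Let conj_commE {g h : gT} : g \in G :\: H -> h \in H ->
  (h ^ g == h) = (h ^+ (2 * n - 2) == 1).
Proof.
move=> gGH hH; rewrite conjE // -(inj_eq (mulIg h^-1)) mulgV.
by rewrite (_ : 2 * n - 1 = (2 * n - 2).+1)%N ?expgSr ?mulgK //; lia.
Qed.

Let exists_out : exists g, g \in G :\: H.
Proof.
apply/set0Pn; rewrite setD_eq0; apply/negP=> sGH.
by have := indexSg sHG sGH; rewrite iG indexgg.
Qed.

(** Centrality of [h] amounts to being fixed by a single g outside [H], that is to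
    [h ^+ (2 * n - 1) = h]. *)
Lemma center_semidihedral_expg {h : gT} :
  h \in H -> (h \in 'Z(G)) = (h ^+ (2 * n - 2) == 1).
Proof.
move=> hH; have [g gGH] := exists_out; have /setDP[gG _] := gGH.
rewrite -(conj_commE gGH hH); apply/idP/eqP => [hZ|/conjg_fixP/commgP gh].
  by apply/conjg_fixP/commgP/commute_sym/(centerC gG).
exact: (index2_cent sHG iG cHH gGH hH (commute_sym gh)).
Qed.

Lemma semidihedral_nonabelian : ~~ abelian G.
Proof.
apply/negP=> /center_idP ZG; have xH := cycle_id x.
have := center_semidihedral_expg xH; rewrite ZG (subsetP sHG) //.
move=> /esym; rewrite -order_dvdn ox => /dvdn_leq; lia.
Qed.

Let nabG := semidihedral_nonabelian.

(** [x ^+ j] is central when 4n divides j(2n - 2). For odd n, 2n - 2 is prime to n, so n divides j;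
    conversely 4 divides 2n - 2. *)
Lemma center_semidihedral_odd : odd n -> 'Z(G) = <[x ^+ n]>.
Proof.
move=> n_odd; apply/eqP; rewrite eqEsubset cycle_subG; apply/andP; split; last first.
  rewrite center_semidihedral_expg ?mem_cycle // -expgM -order_dvdn ox.
  by apply/dvdnP; exists (n./2); lia.
apply/subsetP=> z zZ; have zH := subsetP (center_sub_index2 sHG iG cHH nabG) z zZ.
have := center_semidihedral_expg zH; rewrite zZ.
case/cycleP: zH => j -> /esym; rewrite -expgM -order_dvdn ox => /dvdnP[i Ei].
suff /dvdnP[l ->] : (n %| j)%N by rewrite mulnC expgM mem_cycle.
rewrite -(@Gauss_dvdl _ _ (2 * n - 2)).
  by rewrite Ei; apply/dvdnP; exists (4 * i)%N; lia.
rewrite (_ : 2 * n - 2 = 2 * n.-1)%N; last by lia.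
rewrite coprimeMr coprimen2 n_odd /= -{1}(prednK (ltnW n_gt1)); exact: coprimeSn.
Qed.

(** After halving, 2n divides j(n - 1); for even n the factor n - 1 is prime to 2n and drops out. *)
Lemma center_semidihedral_even : ~~ odd n -> 'Z(G) = <[x ^+ (2 * n)]>.
Proof.
move=> n_even; apply/eqP; rewrite eqEsubset cycle_subG; apply/andP; split; last first.
  rewrite center_semidihedral_expg ?mem_cycle // -expgM -order_dvdn ox.
  by apply/dvdnP; exists n.-1; nia.
apply/subsetP=> z zZ; have zH := subsetP (center_sub_index2 sHG iG cHH nabG) z zZ.
have := center_semidihedral_expg zH; rewrite zZ.
case/cycleP: zH => j -> /esym; rewrite -expgM -order_dvdn ox => /dvdnP[i Ei].
suff /dvdnP[l ->] : (2 * n %| j)%N by rewrite mulnC expgM mem_cycle.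
rewrite -(@Gauss_dvdl _ _ n.-1).
  by apply/dvdnP; exists i; move: Ei; rewrite (_ : 2 * n - 2 = 2 * n.-1)%N; nia.
rewrite coprimeMl -{2}(prednK (ltnW n_gt1)) coprimeSn andbT coprime2n; lia.
Qed.

Lemma card_center_odd : odd n -> #|'Z(G)| = 4.
Proof.
move=> n_odd; rewrite center_semidihedral_odd // -orderE orderXdiv ox ?dvdn_mull //.
by rewrite mulnK //; lia.
Qed.

Lemma card_center_even : ~~ odd n -> #|'Z(G)| = 2.
Proof.
move=> n_even; rewrite center_semidihedral_even // -orderE.
have o2 : (4 * n = 2 * (2 * n))%N by lia.
have dvd2n : (2 * n %| #[x])%N by rewrite ox o2 dvdn_mull.
by rewrite orderXdiv // ox o2 mulnK; lia.
Qed.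

(** Conjugation of [g] by [h^-1] gives [h * g * h^-1 = g * h ^ g * h^-1], and [h ^ g] is
    [h ^+ (2 * n - 1)]. *)
Lemma class_semidihedral_out (g h : gT) : g \in G :\: H -> h \in H ->
  g * h ^+ (2 * n - 2) \in g ^: G.
Proof.
move=> gGH hH; have -> : g * h ^+ (2 * n - 2) = g ^ h^-1.
  rewrite conjgE invgK mulgA (conjgC h g) conjE // -mulgA; congr (_ * _).
  by rewrite (_ : 2 * n - 1 = (2 * n - 2).+1)%N ?expgSr ?mulgK //; lia.
by rewrite memJ_class // groupV (subsetP sHG).
Qed.

(** For representatives a and b, the quotient [t = a^-1 * b] lies in [H]. It suffices to find a
    central power of t that agrees with t up to a (2n - 2)-th power: a times it is then conjugate to
    b. *)
Lemma ccc_adj_out_odd (X Y : ccc_vertex G) : odd n ->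
  ~~ (val X \subset H) -> ~~ (val Y \subset H) -> ccc_adj X Y = (X != Y).
Proof.
move=> n_odd; have [a /setDP[aG _] Xa] := ccc_vertexP X.
have [b /setDP[bG _] Yb] := ccc_vertexP Y.
have nHG : G \subset 'N(H) by apply/normal_norm/index2_normal.
rewrite Xa Yb !class_subset_norm // => aH bH.
have aGH : a \in G :\: H by rewrite inE aH.
have bGH : b \in G :\: H by rewrite inE bH.
rewrite (ccc_adj_out sHG iG cHH X Y aGH bGH) // andb_idr // => _.
have: a^-1 * b \in H by rewrite -mem_lcoset (index2_coset sHG).
set t := a^-1 * b => tH.
have n_half : n = (2 * n./2 + 1)%N by clear - n_odd; lia.
(* [n * n = 1 + (n./2 + 1) * (2n - 2)], and [t ^+ n] is central. *)
apply/exists_inP; exists (t ^+ (n * n)).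
  rewrite center_semidihedral_expg ?groupX // -expgM.
  case/cycleP: tH => j ->; rewrite -expgM -order_dvdn ox.
  apply/dvdnP; exists (j * (n * n./2))%N.
  by move: (n./2) n_half => m ->; clear; nia.
have -> : a * t ^+ (n * n) = b * (t ^+ n./2.+1) ^+ (2 * n - 2).
  rewrite (_ : n * n = 1 + n./2.+1 * (2 * n - 2))%N; last first.
    by move: (n./2) n_half => m ->; clear; nia.
  by rewrite expgD expg1 mulgA mulKVg expgM.
by apply: class_semidihedral_out; rewrite ?groupX.
Qed.

(** Here every central element is a (2n - 2)-th power in [H], so multiplying by it does not leave
    the class and adjacent outer classes would coincide. *)
Lemma ccc_adj_out_even (X Y : ccc_vertex G) : ~~ odd n ->
  ~~ (val X \subset H) -> ~~ (val Y \subset H) -> ccc_adj X Y = false.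
Proof.
move=> n_even; have [a /setDP[aG _] Xa] := ccc_vertexP X.
have [b /setDP[bG _] Yb] := ccc_vertexP Y.
have nHG : G \subset 'N(H) by apply/normal_norm/index2_normal.
rewrite Xa Yb !class_subset_norm // => aH bH.
have aGH : a \in G :\: H by rewrite inE aH.
have bGH : b \in G :\: H by rewrite inE bH.
rewrite (ccc_adj_out sHG iG cHH X Y aGH bGH) //.
apply/negP=> /andP[nXY /exists_inP[z zZ azb]].
case/negP: nXY; rewrite -val_eqE Xa Yb; apply/eqP.
have <- : (a * z) ^: G = b ^: G by apply/class_eqP.
apply/esym/class_eqP; have: z \in <[x ^+ (2 * n)]> by rewrite -center_semidihedral_even.
(* The exponents 2nj and -nj(2n - 2) differ by 2jn^2, a multiple of 4n as n is even. *)
case/cycleP=> j ->; have -> : (x ^+ (2 * n)) ^+ j = (x ^- (n * j)) ^+ (2 * n - 2).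
  apply/eqP; rewrite expgVn eq_sym eq_invg_mul -!expgM -expgD -order_dvdn ox.
  have n_half : n = (2 * n./2.-1.+1)%N by clear - n_gt1 n_even; lia.
  apply/dvdnP; exists (j * n./2.-1.+1)%N; move: n./2.-1 n_half => m ->.
  by rewrite (_ : 2 * (2 * m.+1) - 2 = 4 * m + 2)%N; clear; nia.
by apply: class_semidihedral_out; rewrite ?groupV ?mem_cycle.
Qed.

Lemma card_ccc_in_odd : odd n ->
  #|[set X : ccc_vertex G | val X \subset H]| = (2 * n - 3).+1.
Proof.
move=> n_odd; have := card_ccc_in sHG iG cHH nabG.
by rewrite card_center_odd // -orderE ox; move: #|_| => N; clear - n_gt1 n_odd; lia.
Qed.

Lemma card_ccc_in_even : ~~ odd n ->
  #|[set X : ccc_vertex G | val X \subset H]| = (2 * n - 2).+1.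
Proof.
move=> n_even; have := card_ccc_in sHG iG cHH nabG.
by rewrite card_center_even // -orderE ox; move: #|_| => N; clear - n_gt1 n_even; lia.
Qed.

End SemidihedralCCC.

(** * The connected components of the graph *)

Section SemidihedralComponents.

Context {n : nat} (n_gt1 : (1 < n)%N) {gT : finGroupType} {G : {group gT}} {x : gT}.
Local Notation H := <[x]>%g.
Hypotheses (sHG : H \subset G) (ox : #[x]%g = (4 * n)%N) (iG : #|G : H|%g = 2%N).
Hypothesis conjE : {in G :\: H, forall g, {in H, forall h,
  h ^ g = h ^+ (2 * n - 1)}}%g.

Let cHH : abelian H := cycle_abelian x.
Let nabG := semidihedral_nonabelian n_gt1 sHG ox iG conjE.

Lemma CCC_cluster_odd : odd n ->
  exists f : CCC G -> 'I_2,
    (forall u v : CCC G, adj u v = (u != v) && (f u == f v)) /\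
    (forall i, #|[set v : CCC G | f v == i]|
               = (nth 0 [:: 2 * n - 3; 3] i)%N.+1).
Proof.
(* Component 0 collects the classes inside [H], component 1 the four outside. *)
move=> n_odd; pose f (X : CCC G) : 'I_2 := inord (~~ (val (X : ccc_vertex G) \subset H)).
have fE X : f X = ~~ (val (X : ccc_vertex G) \subset H) :> nat.
  by rewrite inordK // !ltnS leq_b1.
exists f; split=> [X Y|i].
  rewrite -[f X == _]val_eqE /= !fE.
  have [XH|XH] := boolP (val (X : ccc_vertex G) \subset H).
    by rewrite [LHS](ccc_adj_in sHG iG cHH) //; case: (_ \subset _).
  have [YH|YH] := boolP (val (Y : ccc_vertex G) \subset H).
    rewrite andbF; apply: negbTE; apply: contra XH; rewrite ccc_adj_sym.
    by rewrite (ccc_adj_in sHG iG cHH) // => /andP[].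
  by rewrite andbT [LHS](ccc_adj_out_odd n_gt1 sHG ox iG conjE).
case: i => [[|[|//]]] lti /=.
  rewrite -(card_ccc_in_odd n_gt1 sHG ox iG conjE n_odd); apply: eq_card => X.
  by rewrite !inE -val_eqE /= fE; case: (_ \subset _).
apply: etrans (card_center_odd n_gt1 sHG ox iG conjE n_odd).
rewrite -(card_ccc_out sHG iG cHH nabG).
apply: eq_card => X.
by rewrite !inE -val_eqE /= fE; case: (_ \subset _).
Qed.

Lemma CCC_cluster_even : ~~ odd n ->
  exists f : CCC G -> 'I_3,
    (forall u v : CCC G, adj u v = (u != v) && (f u == f v)) /\
    (forall i, #|[set v : CCC G | f v == i]|
               = (nth 0 [:: 2 * n - 2; 0; 0] i)%N.+1).
Proof.
move=> n_even.
have /eqP/cards2P[A [B [neAB outE]]] : #|[set X : ccc_vertex G | ~~ (val X \subset H)]| = 2.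
  by rewrite (card_ccc_out sHG iG cHH nabG) (card_center_even n_gt1 sHG ox iG conjE).
have outP (X : ccc_vertex G) : ~~ (val X \subset H) = (X == A) || (X == B).
  by move/setP/(_ X): outE; rewrite !inE.
have [AH BH] : ~~ (val A \subset H) /\ ~~ (val B \subset H).
  by rewrite !outP !eqxx orbT.
(* Component 0 collects the classes inside [H]; the outer classes [A] and [B] are the isolated
   vertices 1 and 2. *)
pose f (X : CCC G) : 'I_3 :=
  inord (if val (X : ccc_vertex G) \subset H then 0 else (X != A).+1).
have fE X : f X = (if val (X : ccc_vertex G) \subset H then 0 else (X != A).+1) :> nat.
  by rewrite inordK //; case: (_ \subset _); rewrite // !ltnS leq_b1.
exists f; split=> [X Y|i].
  rewrite -[f X == _]val_eqE /= !fE.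
  have [XH|XH] := boolP (val (X : ccc_vertex G) \subset H).
    by rewrite [LHS](ccc_adj_in sHG iG cHH) //; case: (_ \subset _).
  have [YH|YH] := boolP (val (Y : ccc_vertex G) \subset H).
    rewrite andbF; apply: negbTE; apply: contra XH; rewrite ccc_adj_sym.
    by rewrite (ccc_adj_in sHG iG cHH) // => /andP[].
  rewrite [LHS](ccc_adj_out_even n_gt1 sHG ox iG conjE) // eqSS.
  move: XH YH; rewrite !outP => /orP[]/eqP-> /orP[]/eqP->;
    by rewrite ?eqxx ?[B == A]eq_sym ?(negPf neAB) //= ?andbF.
case: i => [[|[|[|//]]]] lti /=.
- rewrite -(card_ccc_in_even n_gt1 sHG ox iG conjE n_even); apply: eq_card => X.
  by rewrite !inE -val_eqE /= fE; case: (_ \subset _).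
- apply: etrans (cards1 (A : CCC G)); apply: eq_card => X; rewrite !inE -val_eqE /= fE.
  rewrite -[RHS]/((X : ccc_vertex G) == A).
  have [->|_] := eqVneq (X : ccc_vertex G) A; first by rewrite (negPf AH).
  by case: (_ \subset _).
apply: etrans (cards1 (B : CCC G)); apply: eq_card => X; rewrite !inE -val_eqE /= fE.
rewrite -[RHS]/((X : ccc_vertex G) == B); have := outP X.
have [->|_] := eqVneq (X : ccc_vertex G) A.
  by rewrite (negPf neAB) (negPf AH).
by case: (_ \subset _) => /= <-.
Qed.

End SemidihedralComponents.

(** * Evaluation of the spectra and energies for the two graphs *)

(** This removes an absolute value around an eigenvalue minus the average degree: the sign is
    decided by an inequality between natural numbers. *)
Lemma dist_ratio_le {C : numFieldType} (c a b : nat) :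
  (c * b.+1 <= a)%N -> `|c%:R - a%:R / b.+1%:R| = a%:R / b.+1%:R - c%:R :> C.
Proof.
move=> cb_a; rewrite distrC ger0_norm // subr_ge0 ler_pdivlMr ?ltr0Sn //.
by rewrite -natrM ler_nat.
Qed.

Lemma dist_ratio_ge {C : numFieldType} (c a b : nat) :
  (a <= c * b.+1)%N -> `|c%:R - a%:R / b.+1%:R| = c%:R - a%:R / b.+1%:R :> C.
Proof.
move=> a_cb; rewrite ger0_norm // subr_ge0 ler_pdivrMr ?ltr0Sn //.
by rewrite -natrM ler_nat.
Qed.

Lemma succ_natr_neq0 {C : numFieldType} {z : C} (k : nat) : z = k.+1%:R -> z != 0.
Proof. by move->; rewrite pnatr_eq0. Qed.

(* From here on, [m] stands for [n - 2]. *)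
Section TwoCliques.

Context {C : numClosedFieldType} {V : sgraph} {m : nat} {f : V -> 'I_2}.
Hypothesis adjE : forall u v : V, adj u v = (u != v) && (f u == f v).
Hypothesis kE : forall i,
  #|[set v : V | f v == i]| = (nth 0 [:: 2 * m + 1; 3] i)%N.+1.

(** The degree sum is (2m + 2)(2m + 1) + 12 on 2m + 6 vertices; the denominator is a successor to
    fit [dist_ratio_le] and [dist_ratio_ge]. *)
Let avg : avg_deg C V = (4 * m ^ 2 + 6 * m + 14)%:R / (2 * m + 5).+1%:R.
Proof.
rewrite (avg_deg_cluster [:: (2 * m + 1)%N; 3%N] f adjE kE) !big_cons !big_nil.
by congr (_%:R / _%:R); lia.
Qed.

Lemma Spec_two_cliques :
  perm_eq (Spec C V) (nseq (2 * m + 4) (-1) ++ [:: 3; (2 * m + 1)%:R]).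
Proof.
apply: (perm_trans (Spec_cluster [:: (2 * m + 1)%N; 3%N] f adjE kE)).
(* Comparing the number of entries satisfying each predicate reduces the permutation to
   arithmetic. *)
apply/seq.permP=> P; rewrite [map _ _]/= /flatten /= -!cats1 /= !count_cat !count_nseq /=.
by case: (P (-1)); lia.
Qed.

Lemma energy_two_cliques : energy C V = 4 * m.+2%:R.
Proof.
rewrite (energy_cluster [:: (2 * m + 1)%N; 3%N] f adjE kE) !big_cons big_nil.
ring.
Qed.

Lemma LSpec_two_cliques :
  perm_eq (LSpec C V) (nseq 2 0 ++ nseq 3 4 ++ nseq (2 * m + 1) (2 * m + 2)%:R).
Proof.
apply: (perm_trans (LSpec_cluster [:: (2 * m + 1)%N; 3%N] f adjE kE)).
apply/seq.permP=> P; rewrite [map _ _]/= /flatten /= -!cats1 /= !count_cat !count_nseq /=.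
rewrite -addnS; lia.
Qed.

Lemma QSpec_two_cliques :
  perm_eq (QSpec C V) ([:: 6; 2; 2; 2; (4 * m + 2)%:R] ++ nseq (2 * m + 1) (2 * m)%:R).
Proof.
apply: (perm_trans (QSpec_cluster [:: (2 * m + 1)%N; 3%N] f adjE kE)).
rewrite [map _ _]/= (_ : (2 * m + 1).-1 = 2 * m)%N; last by lia.
rewrite (_ : 2 * 3 = 6)%N // (_ : 2 * (2 * m + 1) = 4 * m + 2)%N; last by lia.
apply/seq.permP=> P; rewrite /flatten /= -!cats1 /= !count_cat !count_nseq /=.
lia.
Qed.

Lemma Lenergy_two_cliques_small : m = 1%N -> Lenergy C V = 12.
Proof.
move=> m1; rewrite (Lenergy_cluster [:: (2 * m + 1)%N; 3%N] f adjE kE)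
  !big_cons big_nil avg m1.
rewrite dist_ratio_ge // dist_ratio_le // ?dist_ratio_ge //.
by field.
Qed.

(** The eigenvalue 4 of the small clique is below the average degree here, but above it when n = 3,
    where the average is 3. *)
Lemma Lenergy_two_cliques : (3 <= m)%N ->
  Lenergy C V = 2 * (2 * m.+2%:R - 3) * (5 * m.+2%:R - 11) / (m.+2%:R + 1).
Proof.
move=> m_ge3; rewrite (Lenergy_cluster [:: (2 * m + 1)%N; 3%N] f adjE kE)
  !big_cons big_nil avg.
rewrite dist_ratio_ge; last by nia.
rewrite dist_ratio_le // dist_ratio_le; last by nia.
field; apply/andP; split; first by apply: (succ_natr_neq0 (m + 2)); ring.
by apply: (succ_natr_neq0 (2 * m + 5)); ring.
Qed.

(** Among odd n, the eigenvalue 2n - 4 exceeds the average degree only from n = 5 on, and 6 falls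
    below it only from n = 7 on; this isolates n = 3 and n = 5. *)
Lemma Qenergy_two_cliques_m1 : m = 1%N -> Qenergy C V = 12.
Proof.
move=> m1; rewrite (Qenergy_cluster [:: (2 * m + 1)%N; 3%N] f adjE kE)
  !big_cons big_nil avg m1.
rewrite -[(2 * 1 + 1).-1]/2%N dist_ratio_le // dist_ratio_ge //
  ?dist_ratio_le // ?dist_ratio_ge //.
by field.
Qed.

Lemma Qenergy_two_cliques_m3 : m = 3%N -> Qenergy C V = 22.
Proof.
move=> m3; rewrite (Qenergy_cluster [:: (2 * m + 1)%N; 3%N] f adjE kE)
  !big_cons big_nil avg m3.
rewrite -[(2 * 3 + 1).-1]/6%N -[3.-1]/2%N dist_ratio_ge //
  dist_ratio_ge // dist_ratio_le // ?dist_ratio_ge //.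
by field.
Qed.

Lemma Qenergy_two_cliques : (5 <= m)%N ->
  Qenergy C V = 16 * (m.+2%:R - 1) * (m.+2%:R - 3) / (m.+2%:R + 1).
Proof.
move=> m_ge5; rewrite (Qenergy_cluster [:: (2 * m + 1)%N; 3%N] f adjE kE)
  !big_cons big_nil avg.
rewrite -[3.-1]/2%N (_ : (2 * m + 1).-1 = 2 * m)%N; last by lia.
rewrite dist_ratio_ge; last by nia.
rewrite dist_ratio_ge; last by nia.
rewrite dist_ratio_le; last by nia.
rewrite dist_ratio_le; last by nia.
field; apply/andP; split; first by apply: (succ_natr_neq0 (m + 2)); ring.
by apply: (succ_natr_neq0 (2 * m + 5)); ring.
Qed.

End TwoCliques.

Section CliqueAndTwoPoints.

Context {C : numClosedFieldType} {V : sgraph} {m : nat} {f : V -> 'I_3}.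
Hypothesis adjE : forall u v : V, adj u v = (u != v) && (f u == f v).
Hypothesis kE : forall i,
  #|[set v : V | f v == i]| = (nth 0 [:: 2 * m + 2; 0; 0] i)%N.+1.

Let avg : avg_deg C V = ((2 * m + 3) * (2 * m + 2))%:R / (2 * m + 4).+1%:R.
Proof.
rewrite (avg_deg_cluster [:: (2 * m + 2)%N; 0%N; 0%N] f adjE kE) !big_cons !big_nil.
by congr (_%:R / _%:R); lia.
Qed.

Lemma Spec_clique_points :
  perm_eq (Spec C V) (nseq (2 * m + 2) (-1) ++ [:: 0; 0; (2 * m + 2)%:R]).
Proof.
apply: (perm_trans (Spec_cluster [:: (2 * m + 2)%N; 0%N; 0%N] f adjE kE)).
by rewrite /= -cats1 -catA perm_cat2l perm_catC.
Qed.

Lemma energy_clique_points : energy C V = 4 * m.+2%:R - 4.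
Proof.
rewrite (energy_cluster [:: (2 * m + 2)%N; 0%N; 0%N] f adjE kE) !big_cons big_nil.
ring.
Qed.

Lemma LSpec_clique_points :
  perm_eq (LSpec C V) (nseq 3 0 ++ nseq (2 * m + 2) (2 * m + 3)%:R).
Proof.
apply: (perm_trans (LSpec_cluster [:: (2 * m + 2)%N; 0%N; 0%N] f adjE kE)).
by rewrite /= -cats1 -catA perm_catC -addnS.
Qed.

Lemma QSpec_clique_points :
  perm_eq (QSpec C V) ([:: 0; 0; (4 * m + 4)%:R] ++ nseq (2 * m + 2) (2 * m + 1)%:R).
Proof.
apply: (perm_trans (QSpec_cluster [:: (2 * m + 2)%N; 0%N; 0%N] f adjE kE)).
rewrite [map _ _]/= (_ : (2 * m + 2).-1 = 2 * m + 1)%N; last by lia.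
rewrite muln0 (_ : 2 * (2 * m + 2) = 4 * m + 4)%N; last by lia.
by rewrite /= -cats1 perm_catC /= !perm_cons perm_catC.
Qed.

Lemma Lenergy_clique_points :
  Lenergy C V = 6 * (2 * m.+2%:R - 1) * (2 * m.+2%:R - 2) / (2 * m.+2%:R + 1).
Proof.
rewrite (Lenergy_cluster [:: (2 * m + 2)%N; 0%N; 0%N] f adjE kE)
  !big_cons big_nil avg.
rewrite dist_ratio_ge; last by nia.
rewrite dist_ratio_le //.
by field; apply: (succ_natr_neq0 (2 * m + 4)); ring.
Qed.

(** For n = 2 the eigenvalue 2n - 3 = 1 is below the average degree 6/5; for even n at least 4 it is
    above. *)
Lemma Qenergy_clique_points_small : m = 0%N -> Qenergy C V = 28 / 5.
Proof.
move=> m0; rewrite (Qenergy_cluster [:: (2 * m + 2)%N; 0%N; 0%N] f adjE kE)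
  !big_cons big_nil avg m0.
rewrite -[(2 * 0 + 2).-1]/1%N -[0.-1]/0%N muln0 dist_ratio_le //
  dist_ratio_ge // ?dist_ratio_le //.
by field.
Qed.

Lemma Qenergy_clique_points : (2 <= m)%N ->
  Qenergy C V = 4 * (2 * m.+2%:R - 1) * (2 * m.+2%:R - 2) / (2 * m.+2%:R + 1).
Proof.
move=> m_ge2; rewrite (Qenergy_cluster [:: (2 * m + 2)%N; 0%N; 0%N] f adjE kE)
  !big_cons big_nil avg.
rewrite -[0.-1]/0%N muln0 (_ : (2 * m + 2).-1 = 2 * m + 1)%N; last by lia.
rewrite dist_ratio_ge; last by nia.
rewrite dist_ratio_ge; last by nia.
rewrite dist_ratio_le //.
by field; apply: (succ_natr_neq0 (2 * m + 4)); ring.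
Qed.

End CliqueAndTwoPoints.

(** * Assembly by parity of n *)

Theorem theorem3p5 (C : numClosedFieldType) (n : nat) (n_ge2 : (2 <= n)%N)
    (gT : finGroupType) (G : {group gT})
    (G_SD8n : (G \isog Grp (x : y : x ^+ (4 * n)%N, y ^+ 2,
                            y * x * y = x ^+ (2 * n - 1)%N))%g) :
  [/\ [/\ odd n ->
            perm_eq (Spec C (CCC G))
              (nseq (2 * n) (-1) ++ nseq 1 3 ++ nseq 1 (2 * n%:R - 3)),
          ~~ odd n ->
            perm_eq (Spec C (CCC G))
              (nseq (2 * n - 2) (-1) ++ nseq 2 0 ++ nseq 1 (2 * n%:R - 2)),
          odd n -> energy C (CCC G) = 4 * n%:R &
          ~~ odd n -> energy C (CCC G) = 4 * n%:R - 4],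
      [/\ odd n ->
            perm_eq (LSpec C (CCC G))
              (nseq 2 0 ++ nseq 3 4 ++ nseq (2 * n - 3) (2 * n%:R - 2)),
          ~~ odd n ->
            perm_eq (LSpec C (CCC G))
              (nseq 3 0 ++ nseq (2 * n - 2) (2 * n%:R - 1)),
          n = 3%N -> Lenergy C (CCC G) = 12,
          odd n -> (5 <= n)%N ->
            Lenergy C (CCC G) =
              2 * (2 * n%:R - 3) * (5 * n%:R - 11) / (n%:R + 1) &
          ~~ odd n ->
            Lenergy C (CCC G) =
              6 * (2 * n%:R - 1) * (2 * n%:R - 2) / (2 * n%:R + 1)] &
      [/\ odd n ->
            perm_eq (QSpec C (CCC G))
              (nseq 1 6 ++ nseq 3 2 ++ nseq 1 (4 * n%:R - 6) ++
               nseq (2 * n - 3) (2 * n%:R - 4)),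
          ~~ odd n ->
            perm_eq (QSpec C (CCC G))
              (nseq 2 0 ++ nseq 1 (4 * n%:R - 4) ++
               nseq (2 * n - 2) (2 * n%:R - 3)) &
          [/\ n = 3%N -> Qenergy C (CCC G) = 12,
              n = 5%N -> Qenergy C (CCC G) = 22,
              odd n -> (7 <= n)%N ->
                Qenergy C (CCC G) =
                  16 * (n%:R - 1) * (n%:R - 3) / (n%:R + 1),
              n = 2%N -> Qenergy C (CCC G) = 28 / 5 &
              ~~ odd n -> (4 <= n)%N ->
                Qenergy C (CCC G) =
                  4 * (2 * n%:R - 1) * (2 * n%:R - 2) / (2 * n%:R + 1)]]].
Proof.
(* Writing n as m + 2 turns the truncated differences into sums, matching the clique
   computations. *)
case: n n_ge2 G_SD8n => [|[|m]] // n_gt1 isoG.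
have [x [sHG ox iG conjE]] := semidihedral_generators n_gt1 G isoG.
have nat3 : (2 * m.+2 - 3 = 2 * m + 1)%N by clear; lia.
have nat2 : (2 * m.+2 - 2 = 2 * m + 2)%N by clear; lia.
have nat4 : (2 * m.+2 = 2 * m + 4)%N by clear; lia.
have e1 : 2 * m.+2%:R - 1 = (2 * m + 3)%:R :> C by ring.
have e2 : 2 * m.+2%:R - 2 = (2 * m + 2)%:R :> C by ring.
have e3 : 2 * m.+2%:R - 3 = (2 * m + 1)%:R :> C by ring.
have e4 : 2 * m.+2%:R - 4 = (2 * m)%:R :> C by ring.
have f4 : 4 * m.+2%:R - 4 = (4 * m + 4)%:R :> C by ring.
have f6 : 4 * m.+2%:R - 6 = (4 * m + 2)%:R :> C by ring.
have [n_odd|n_even] := boolP (odd m.+2).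
  have [f [adjE]] := CCC_cluster_odd n_gt1 sHG ox iG conjE n_odd.
  rewrite nat3 => kE; split.
  - split=> // _; last exact: energy_two_cliques adjE kE.
    by rewrite nat4 e3; apply: Spec_two_cliques adjE kE.
  - split=> // [_|[m1]|_ m_ge3].
    + by rewrite e2; apply: LSpec_two_cliques adjE kE.
    + exact: Lenergy_two_cliques_small adjE kE m1.
    exact: Lenergy_two_cliques adjE kE m_ge3.
  split=> // [_|].
    by rewrite f6 e4; apply: QSpec_two_cliques adjE kE.
  split=> // [[m1]|[m3]|_ m_ge5|[m0]].
  - exact: Qenergy_two_cliques_m1 adjE kE m1.
  - exact: Qenergy_two_cliques_m3 adjE kE m3.
  - exact: Qenergy_two_cliques adjE kE m_ge5.
  by rewrite m0 in n_odd.
have [f [adjE]] := CCC_cluster_even n_gt1 sHG ox iG conjE n_even.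
rewrite nat2 => kE; split.
- split=> // _; last exact: energy_clique_points adjE kE.
  by rewrite e2; apply: Spec_clique_points adjE kE.
- split=> // [_|[m1]|_].
  + by rewrite e1; apply: LSpec_clique_points adjE kE.
  + by rewrite m1 in n_even.
  exact: Lenergy_clique_points adjE kE.
split=> // [_|].
  by rewrite f4 e3; apply: QSpec_clique_points adjE kE.
split=> // [[m1]|[m3]|[m0]|_ m_ge2].
- by rewrite m1 in n_even.
- by rewrite m3 in n_even.
- exact: Qenergy_clique_points_small adjE kE m0.
exact: Qenergy_clique_points adjE kE m_ge2.
Qed.
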